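(* Let $n\ge1$, $k\in\{1,\dots,n\}$, and $\mathfrak o$ a compact discrete valuation ring with maximal ideal $\mathfrak p$ and residue field of cardinality $q$. Then $$\Delta_{n,k}(q)=\sum_{a=k}^n\sum_{b=0}^{n-a}q^{b(a+b+1)}\,\#\mathcal L_{a,b}(\mathfrak o^n)\,\#\mathrm{Sym}_{a,a-k}(\mathbb F_q).$$
   Context: $\binom{a}{b}_Y=\prod_{i=1}^b\frac{1-Y^{a-i+1}}{1-Y^i}$; for $k>0$, $\Delta_{n,k}(Y)=Y^{\binom{n-k+1}{2}}\binom{n}{k}_Y\prod_{i=1}^{n-k}(1+Y^{k+i})$. $\mathcal L_{a,b}(\mathfrak o^n)$ is the set of $\mathfrak o$-submodules $\Lambda\le\mathfrak o^n$ with $\mathfrak o^n/\Lambda\cong(\mathfrak o/\mathfrak p)^a\oplus(\mathfrak o/\mathfrak p^2)^b$. $\mathrm{Sym}_{a,r}(\mathbb F_q)$ is the set of symmetric $a\times a$ matrices of rank $r$ over $\mathbb F_q$. (In the paper's notation the factor $\#\mathcal L_{a,b}(\mathfrak o^n)$ appears as $\psi_{n,0,\mathfrak o}(\omega_{a,b}(\mathfrak o^n))$, which equals it by definition.) *)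

(* Defs.v *)
From HB Require Import structures.
From mathcomp Require Import all_boot all_order all_algebra.
From mathcomp Require Import finmap.
From mathcomp Require Import all_classical all_reals all_analysis.

Set Implicit Arguments.
Unset Strict Implicit.
Unset Printing Implicit Defensive.

Import Order.TTheory GRing.Theory Num.Theory.
Local Open Scope classical_set_scope.
Local Open Scope ring_scope.

(* Every set is the collective predicate of its membership test (by boolp), so
   [submodClosed V] is the type of all R-submodules of V, and
   [submodClosed R^o] is the type of all ideals of a commutative ring R,
   the improper ideal R included. *)

Section QuotientModule.
Variables (R : nzRingType) (V : lmodType R) (S : submodClosed V).

Definition submod_pred : V -> bool := fun v => v \in S.

Lemma submod_pred_zmod_closed : zmod_closed submod_pred.
Proof. exact: GRing.submod_closedB (submodClosedP S). Qed.

HB.instance Definition _ :=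
  GRing.isZmodClosed.Build V submod_pred submod_pred_zmod_closed.

Definition submod_zmod : zmodClosed V := GRing.ZmodClosed.clone V submod_pred _.

Definition quotmod := @Quotient.quot V submod_zmod.

HB.instance Definition _ := GRing.Zmodule.on quotmod.

Definition quotmod_scale (a : R) (x : quotmod) : quotmod :=
  \pi_quotmod%qT (a *: generic_quotient.repr x).

Lemma quotmod_piE (u v : V) : u - v \in S ->
  \pi_quotmod%qT u = \pi_quotmod%qT v.
Proof. by move=> uv; apply/eqP; rewrite -Quotient.idealrBE. Qed.

Lemma quotmod_reprB (v : V) :
  generic_quotient.repr (\pi_quotmod%qT v) - v \in S.
Proof.
have := Quotient.idealrBE submod_zmod
  (generic_quotient.repr (\pi_quotmod%qT v)) v.
by rewrite generic_quotient.reprK eqxx.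
Qed.

Lemma quotmod_scale_pi a v :
  quotmod_scale a (\pi_quotmod%qT v) = \pi_quotmod%qT (a *: v).
Proof.
by apply: quotmod_piE; rewrite -scalerBr; apply: rpredZ; apply: quotmod_reprB.
Qed.

Lemma quotmod_piD (u v : V) :
  \pi_quotmod%qT (u + v) = \pi_quotmod%qT u + \pi_quotmod%qT v :> quotmod.
Proof. exact: (@Quotient.pi_add _ submod_zmod). Qed.

Lemma quotmod_scaleA a b x :
  quotmod_scale a (quotmod_scale b x) = quotmod_scale (a * b) x.
Proof. by rewrite [in RHS]/quotmod_scale quotmod_scale_pi scalerA. Qed.

Lemma quotmod_scale1 : left_id 1 quotmod_scale.
Proof. by move=> x; rewrite /quotmod_scale scale1r generic_quotient.reprK. Qed.

Lemma quotmod_scaleDr : right_distributive quotmod_scale +%R.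
Proof.
move=> a x y; rewrite -[x]generic_quotient.reprK -[y]generic_quotient.reprK.
by rewrite -quotmod_piD !quotmod_scale_pi scalerDr quotmod_piD.
Qed.

Lemma quotmod_scaleDl x : {morph quotmod_scale^~ x : a b / a + b}.
Proof. by move=> a b; rewrite /quotmod_scale scalerDl quotmod_piD. Qed.

HB.instance Definition _ := GRing.Zmodule_isLmodule.Build R quotmod
  quotmod_scaleA quotmod_scale1 quotmod_scaleDr quotmod_scaleDl.

End QuotientModule.

Definition lmod_isom (R : nzRingType) (M N : lmodType R) : Prop :=
  exists f : {linear M -> N}, bijective f.

Section Ideals.
Variable R : comNzRingType.

Definition ideal_full_pred : R^o -> bool := fun=> true.

Lemma ideal_full_closed : submod_closed ideal_full_pred.
Proof. by []. Qed.

HB.instance Definition _ :=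
  GRing.isSubmodClosed.Build R R^o ideal_full_pred ideal_full_closed.

Definition ideal_full : submodClosed R^o :=
  GRing.SubmodClosed.clone R R^o ideal_full_pred _.

Section Product.
Variables I J : submodClosed R^o.

Definition ideal_mul_pred : R^o -> bool := fun x =>
  `[< exists s : seq (R^o * R^o),
        (forall u, u \in s -> u.1 \in I /\ u.2 \in J) /\
        x = \sum_(u <- s) (u.1 : R) * (u.2 : R) >].

Lemma ideal_mul_closed : submod_closed ideal_mul_pred.
Proof.
split; first by apply/asboolP; exists [::]; rewrite big_nil.
move=> a x y /asboolP[s [sIJ ->]] /asboolP[t [tIJ ->]]; apply/asboolP.
exists ([seq (a *: u.1, u.2) | u <- s] ++ t); split.
  move=> u; rewrite mem_cat => /orP[/mapP[v /sIJ[vI vJ] ->]|/tIJ//].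
  by split => //=; apply: rpredZ.
rewrite big_cat big_map; congr (_ + _).
by rewrite scaler_sumr; apply: eq_bigr => u _; exact: mulrA.
Qed.

HB.instance Definition _ :=
  GRing.isSubmodClosed.Build R R^o ideal_mul_pred ideal_mul_closed.

Definition ideal_mul : submodClosed R^o :=
  GRing.SubmodClosed.clone R R^o ideal_mul_pred _.

End Product.

Definition ideal_pow (I : submodClosed R^o) (m : nat) : submodClosed R^o :=
  iterop m ideal_mul I ideal_full.

Definition principal_ideal (I : submodClosed R^o) : Prop :=
  exists x : R, forall y : R, (y : R^o) \in I <-> exists c : R, y = c * x.

Definition maximal_ideal (I : submodClosed R^o) : Prop :=
  (1 : R^o) \notin I /\
  forall J : submodClosed R^o,
    (1 : R^o) \notin J -> {subset I <= J} -> J =i I.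

End Ideals.

(* A discrete valuation ring is a local principal ideal domain that is not a
   field, i.e. whose unique maximal ideal p is nonzero. *)
Record is_dvr (R : idomainType) (p : submodClosed R^o) : Prop := IsDvr {
  dvr_pid : forall I : submodClosed R^o, principal_ideal I;
  dvr_maximal : maximal_ideal p;
  dvr_local : forall J : submodClosed R^o, maximal_ideal J -> J =i p;
  dvr_not_field : exists2 x : R^o, x \in p & x != 0 }.

(* The ring R equipped with its p-adic topology. *)
Definition adic (R : comNzRingType) (p : submodClosed R^o) : Type := R.

Section AdicTopology.
Variables (R : comNzRingType) (p : submodClosed R^o).

HB.instance Definition _ := Choice.copy (adic p) R.

Definition adic_open (U : set (adic p)) : Prop :=
  forall x : R, U x ->
    exists m, forall y : R, (y - x : R^o) \in ideal_pow p m -> U y.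

Lemma ideal_powS_sub m : {subset ideal_pow p m.+1 <= ideal_pow p m}.
Proof.
case: m => [//|m] x; rewrite /ideal_pow !iteropS !iterS.
elim: m x => [|m IHm] x /asboolP[s [sIJ ->]] /=.
  rewrite big_seq; apply: rpred_sum => u /sIJ[uI uJ].
  by rewrite mulrC; apply: (@rpredZ R R^o p).
apply/asboolP; exists s; split=> // u /sIJ[uI uJ]; split=> //.
exact: IHm.
Qed.

Lemma ideal_pow_sub m k : (m <= k)%N ->
  {subset ideal_pow p k <= ideal_pow p m}.
Proof.
move=> /subnK <-; elim: (k - m)%N => [//|d IHd] x; rewrite addSn.
by move=> /ideal_powS_sub /IHd.
Qed.

Lemma adic_openT : adic_open setT.
Proof. by move=> x _; exists 0%N. Qed.

Lemma adic_openI : setI_closed adic_open.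
Proof.
move=> A B oA oB x [/oA[m mA] /oB[k kB]]; exists (maxn m k) => y yx.
split; [apply: mA | apply: kB].
  exact: ideal_pow_sub (leq_maxl m k) _ yx.
exact: ideal_pow_sub (leq_maxr m k) _ yx.
Qed.

Lemma adic_open_bigU (I : Type) (f : I -> set (adic p)) :
  (forall i, adic_open (f i)) -> adic_open (\bigcup_i f i).
Proof.
move=> of_ x [i _ /of_[m mf]]; exists m => y /mf fy; by exists i.
Qed.

HB.instance Definition _ :=
  isOpenTopological.Build (adic p) adic_openT adic_openI adic_open_bigU.

End AdicTopology.

Definition is_compact_dvr (R : idomainType) (p : submodClosed R^o) : Prop :=
  is_dvr p /\ compact [set: adic p].

(* (o/p)^a (+) (o/p^2)^b *)
Definition elem_mod (R : idomainType) (p : submodClosed R^o) (a b : nat) :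
    lmodType R :=
  ({ffun 'I_a -> quotmod p} * {ffun 'I_b -> quotmod (ideal_pow p 2)})%type.

Definition calL (R : idomainType) (p : submodClosed R^o) (n a b : nat) :
    set (set 'rV[R]_n) :=
  [set L | exists S : submodClosed 'rV[R]_n,
     L = [set` S] /\ lmod_isom (quotmod S) (elem_mod p a b)].
Arguments calL {R} p n a b _.

(* Number of elements of a finite set; 0 on infinite sets. *)
Definition ncard (T : choiceType) (A : set T) : nat := #|` fset_set A|%fset.

Definition Sym (F : finFieldType) (a r : nat) : {set 'M[F]_a} :=
  [set A : 'M[F]_a | (A^T == A) && (\rank A == r)]%SET.

(* [a.+1 - i] is the exponent a - i + 1: the truncation is harmless, since
   for b > a the factor i = a.+1 is zero in any case. *)
Definition qbinom (K : fieldType) (a b : nat) (Y : K) : K :=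
  \prod_(1 <= i < b.+1) ((1 - Y ^+ (a.+1 - i)) / (1 - Y ^+ i)).

Definition Delta (K : fieldType) (n k : nat) (Y : K) : K :=
  Y ^+ 'C(n - k + 1, 2) * qbinom n k Y *
  \prod_(1 <= i < (n - k).+1) (1 + Y ^+ (k + i)).

(* Main.v *)
(* Lattices of type (a, b) are the kernels of the surjections o^n -> E onto
   E = (o/p)^a (+) (o/p^2)^b. By Nakayama these surjections are the n-tuples
   in E whose reductions span E/pE, and two of them have the same kernel iff
   they differ by an automorphism of E; hence, with [m]! the q-factorial,
     #L_{a,b}(o^n) = q^(b(n-a-b)) [n]! / ([n-a-b]! [a]! [b]!).
   A symmetric a x a matrix of rank r is determined by its row space and a
   nondegenerate form on it, so that #Sym_{a,r} = N(r) [a]! / ([r]! [a-r]!)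
   with N(r) = #Sym_{r,r}. Put m = n - k and y = q^(n+1): the right-hand side is
   then binom(n,k) * sum_b binom(m,b) y^b sum_s binom(m-b,s) N(s). The inner sum
   counts all symmetric matrices of size m - b, whence it equals
   q^(binom(m-b+1,2)), and the q-binomial theorem turns the sum over b into
   prod_{j=1}^m (y + q^j), which is Delta_{n,k}(q) / binom(n,k). *)
From HB Require Import structures.
Require Import Defs.
From mathcomp Require Import all_boot all_order all_algebra.
From mathcomp Require Import finmap zify ring.
From mathcomp Require Import all_classical all_reals all_analysis.

Set Implicit Arguments.
Unset Strict Implicit.
Unset Printing Implicit Defensive.

Import Order.TTheory GRing.Theory Num.Theory.
Local Open Scope ring_scope.

(** * Row-free and symmetric matrices over a finite field *)

(** The number of linearly independent [c]-tuples in [F_q^n]. For [c > n] the factor [i = n] makes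
    the product zero, so truncated subtraction does no harm. *)
Definition nfree (q n c : nat) : nat := (\prod_(i < c) (q ^ n - q ^ i))%N.

Section FiniteFieldCounts.
Variable F : finFieldType.

Lemma card_submx_row_free (c n : nat) (X : 'M[F]_(c, n)) : row_free X ->
  #|[set v : 'rV[F]_n | (v <= X)%MS]%SET| = (#|F| ^ c)%N.
Proof.
move=> freeX; have -> : [set v : 'rV[F]_n | (v <= X)%MS]%SET =
    [set u *m X | u : 'rV[F]_c]%SET.
  apply/setP=> v; rewrite inE; apply/idP/imsetP=> [/submxP[u ->]|[u _ ->]].
    by exists u.
  exact: submxMl.
by rewrite card_imset ?card_mx ?mul1n //; apply: row_free_inj.
Qed.

Lemma row_free_col_mx1 (c n : nat) (v : 'rV[F]_n) (X : 'M[F]_(c, n)) :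
  row_free (col_mx v X) = row_free X && ~~ (v <= X)%MS.
Proof.
rewrite /row_free -(addsmxE v X); have [vX|vX] := boolP (v <= X)%MS.
  rewrite andbF (addsmx_idPr vX); apply: negbTE.
  by rewrite neq_ltn add1n ltnS rank_leq_row.
have [vX_v cap_eq] := mxrank_leqif_sup (capmxSl v X).
rewrite sub_capmx submx_refl (negPf vX) in cap_eq.
have : (\rank (v :&: X)%MS < \rank v)%N by rewrite ltn_neqAle cap_eq.
have := mxrank_sum_cap v X.
rewrite rank_rV; case: (v != 0) => //= sum_cap; rewrite ltnS leqn0 => /eqP cap0.
by rewrite cap0 addn0 in sum_cap; rewrite sum_cap eqn_add2l andbT.
Qed.

(** A new row keeps [X] row-free iff it avoids the row space of [X], which has [q^c] elements; this
    gives the factor [q^n - q^c]. *)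
Lemma card_row_free (n c : nat) :
  #|[set X : 'M[F]_(c, n) | row_free X]%SET| = nfree #|F| n c.
Proof.
elim: c => [|c IHc].
  rewrite /nfree big_ord0 (_ : finset _ = [set: _]%SET).
    by rewrite cardsT card_mx expn0.
  by apply/setP=> X; rewrite !inE /row_free -leqn0 rank_leq_row.
rewrite /nfree big_ord_recr /= -/(nfree _ _ _) -IHc.
have colK : bijective (fun Xv : 'M[F]_(c, n) * 'rV[F]_n => col_mx Xv.2 Xv.1).
  exists (fun Y : 'M[F]_(1 + c, n) => (dsubmx Y, usubmx Y)) => [[X v]|Y] /=.
    by rewrite col_mxKu col_mxKd.
  by rewrite vsubmxK.
rewrite -[LHS](on_card_preimset (onW_bij _ colK)) -sum_nat_const.
transitivity (\sum_(X in [set X : 'M[F]_(c, n) | row_free X]%SET)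
    \sum_(v : 'rV[F]_n | ~~ (v <= X)%MS) 1)%N.
  rewrite -sum1_card pair_big_dep /=; apply: eq_bigl => -[X v].
  by rewrite !inE; apply: row_free_col_mx1.
apply: eq_bigr => X; rewrite inE => freeX.
rewrite sum1_card -(card_submx_row_free freeX).
have := cardsC [set v : 'rV[F]_n | (v <= X)%MS]%SET.
rewrite card_mx mul1n => <-; rewrite addKn; apply: eq_card => v.
by rewrite !inE.
Qed.

Lemma card_row_full (n c : nat) :
  #|[set X : 'M[F]_(n, c) | row_full X]%SET| = nfree #|F| n c.
Proof.
rewrite -card_row_free -(card_imset _ (can_inj (@trmxK F n c))).
apply: eq_card => X; rewrite inE; apply/imsetP/idP => [[Y]|freeX].
  by rewrite inE => fullY ->; rewrite /row_free mxrank_tr.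
by exists X^T; rewrite ?trmxK // inE /row_full mxrank_tr.
Qed.

(** The bases of a fixed [r]-dimensional space form a torsor under [GL_r]: with one basis [B]
    chosen, they are the products [g *m B]. *)
Lemma card_row_free_row_space (a r : nat) (A : 'M[F]_a) : \rank A = r ->
  #|[set P : 'M[F]_(r, a) | row_free P && (P == A)%MS]%SET| = nfree #|F| r r.
Proof.
move=> rA.
have [B freeB BA] : exists2 B : 'M[F]_(r, a), row_free B & (B :=: A)%MS.
  move: rA; case: _ / => //.
  by exists (row_base A); [exact: row_base_free|exact: eq_row_base].
rewrite -card_row_free -(card_imset _ (row_free_inj freeB)).
apply: eq_card => P; rewrite inE; apply/andP/imsetP.
  case=> freeP PA; have /submxP[g Pg] : (P <= B)%MS.
    by rewrite BA; case/andP: PA.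
  exists g => //; rewrite inE; move: freeP.
  by rewrite Pg /row_free mxrankMfree.
case=> g; rewrite inE => freeg ->; split.
  by rewrite /row_free mxrankMfree.
apply/eqmxP; apply: eqmx_trans BA; apply: eqmxMfull.
by rewrite row_full_unit -row_free_unit.
Qed.

(** Congruence [B |-> P^T *m B *m P] is a bijection from the nondegenerate symmetric [r x r]
    matrices onto the symmetric matrices with the row space of [P]. *)
Lemma card_Sym_row_space (a r : nat) (P : 'M[F]_(r, a)) : row_free P ->
  #|[set A in Sym F a r | (P == A)%MS]%SET| = #|Sym F r r|.
Proof.
move=> freeP.
have /row_freeP[Q freePV] := freeP.
have congr_inj : injective (fun B : 'M[F]_r => P^T *m B *m P).
  apply: (can_inj (g := fun A => Q^T *m A *m Q)) => B.
  by rewrite !mulmxA -trmx_mul freePV trmx1 mul1mx -mulmxA freePV mulmx1.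
rewrite -(card_imset _ congr_inj); apply: eq_card => A; rewrite !inE.
apply/idP/imsetP=> [/andP[/andP[/eqP symA /eqP rA]]|[B]].
  case/andP=> _ /submxP[X AX].
  (* [Q] is a right inverse of [P], so [Q *m P] fixes every matrix whose rows lie in the row space
     of [P]; by symmetry [P^T *m Q^T] fixes [A] from the left. *)
  have AQP : A *m Q *m P = A by rewrite {1}AX -(mulmxA X) freePV mulmx1 AX.
  have AE : A = P^T *m (Q^T *m A *m Q) *m P.
    rewrite -{1}AQP !mulmxA; congr (_ *m _ *m _).
    by rewrite -{1}symA -{1}AQP !trmx_mul symA !mulmxA.
  exists (Q^T *m A *m Q) => //; rewrite inE !trmx_mul symA trmxK mulmxA eqxx /=.
  rewrite eqn_leq rank_leq_row -{1}rA {1}AE.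
  by rewrite (leq_trans (mxrankM_maxl _ _)) ?mxrankM_maxr.
rewrite inE => /andP[/eqP symB /eqP rB] ->.
rewrite !trmx_mul trmxK symB mulmxA eqxx /=.
have PBP : (P^T *m B *m P == P)%MS.
  apply/eqmxP/eqmxMfull.
  by rewrite /row_full -mxrank_tr trmx_mul trmxK symB mxrankMfree ?rB.
rewrite (eqmx_rank PBP) (eqP freeP) eqxx /=.
by move: PBP; rewrite andbC.
Qed.

(** Double counting of the pairs [(A, P)] where [P] is a basis of the row space of [A]. *)
Lemma card_Sym_rank (a r : nat) :
  (#|Sym F a r| * nfree #|F| r r = nfree #|F| a r * #|Sym F r r|)%N.
Proof.
rewrite -(card_row_free a r) -!sum_nat_const.
transitivity (\sum_(A in Sym F a r)
  \sum_(P : 'M[F]_(r, a) | row_free P && (P == A)%MS) 1)%N.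
  apply: eq_bigr => A; rewrite inE => /andP[_ /eqP rA].
  rewrite -(card_row_free_row_space rA) -sum1_card.
  by apply: eq_bigl => P; rewrite inE.
rewrite (exchange_big_dep
  (fun P => P \in [set P : 'M[F]_(r, a) | row_free P]%SET)) /=.
  apply: eq_bigr => P; rewrite inE => freeP.
  rewrite -(card_Sym_row_space freeP) -sum1_card; apply: eq_bigl => A.
  by rewrite [RHS]inE freeP.
by move=> A P _ /andP[freeP _]; rewrite inE.
Qed.

Lemma card_symmetric (a : nat) :
  #|[set A : 'M[F]_a | A^T == A]%SET| = (#|F| ^ 'C(a.+1, 2))%N.
Proof.
elim: a => [|a IHa].
  rewrite (_ : finset _ = [set: _]%SET) ?cardsT ?card_mx //.
  by apply/setP=> A; rewrite !inE; apply/eqP; rewrite [LHS]thinmx0 [RHS]thinmx0.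
rewrite binS bin1 expnD -IHa.
(* [t.1] is the first row, diagonal entry included; symmetry determines the first column. *)
pose f (t : 'rV[F]_(1 + a) * 'M[F]_a) : 'M[F]_(1 + a) :=
  block_mx (lsubmx t.1) (rsubmx t.1) (rsubmx t.1)^T t.2.
have f_inj : injective f.
  move=> [u A] [v B] /eq_block_mx[/= uv1 uv2 _ ->].
  by rewrite -(hsubmxK u) uv1 uv2 hsubmxK.
rewrite -[LHS]/(#|[set A : 'M[F]_(1 + a) | A^T == A]%SET|).
have -> : (#|F| ^ a.+1)%N = #|[set: 'rV[F]_(1 + a)]%SET|.
  by rewrite cardsT card_mx mul1n.
rewrite mulnC -cardsX -(card_imset _ f_inj); apply: eq_card => A.
rewrite !inE; apply/idP/imsetP=> [/eqP symA|[[u B]]].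
  exists (row_mx (ulsubmx A) (ursubmx A), drsubmx A).
    by rewrite !inE /= trmx_drsub symA.
  rewrite /f /= row_mxKl row_mxKr trmx_ursub symA.
  by rewrite submxK.
rewrite !inE /= => /eqP symB ->; rewrite /f /= tr_block_mx trmxK symB.
rewrite [(lsubmx u)^T](_ : _ = lsubmx u) //.
by apply/matrixP=> i j; rewrite mxE (ord1 i) (ord1 j).
Qed.

Lemma sum_card_Sym (a : nat) :
  (\sum_(r < a.+1) #|Sym F a r| = #|F| ^ 'C(a.+1, 2))%N.
Proof.
rewrite -card_symmetric -sum1_card.
rewrite (partition_big
  (fun A : 'M[F]_a => inord (\rank A) : 'I_a.+1) xpredT) //=.
apply: eq_bigr => r _; rewrite -sum1_card; apply: eq_bigl => A; rewrite !inE.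
by congr (_ && _); rewrite -val_eqE /= inordK // ltnS rank_leq_row.
Qed.

(** These are the reductions of the automorphisms of [E]: the generators of [(o/p)^a] are killed by
    [pi], so their images have zero residue in the [o/p^2] part. *)
Lemma card_row_free_lower_block (a b : nat) :
  #|[set X : 'M[F]_(a + b) | row_free X && (ursubmx X == 0)]%SET| =
  (nfree #|F| a a * nfree #|F| b b * #|F| ^ (b * a))%N.
Proof.
rewrite -!card_row_free -card_mx -cardsT -!cardsX.
pose f (t : 'M[F]_a * 'M[F]_b * 'M[F]_(b, a)) := block_mx t.1.1 0 t.2 t.1.2.
have f_inj : injective f.
  by move=> [[A D] C] [[A' D'] C'] /eq_block_mx[/= -> _ -> ->].
have fE t : row_free (f t) = row_free t.1.1 && row_free t.1.2.
  by rewrite !row_free_unit !unitmxE det_lblock unitrM.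
rewrite -(card_imset _ f_inj); apply: eq_card => X.
rewrite inE; apply/andP/imsetP=> [[freeX /eqP X0]|[t]].
  exists (ulsubmx X, drsubmx X, dlsubmx X); last by rewrite /f /= -X0 submxK.
  by rewrite !inE andbT -(fE (_, _, dlsubmx X)) /f /= -X0 submxK.
by rewrite !inE andbT -fE => ft ->; rewrite ft block_mxKur.
Qed.

End FiniteFieldCounts.

(** * Gaussian binomials *)

Section GaussianBinomials.
Variables (K : comNzRingType) (Q : K).

(** The q-factorial without its denominator [(Q - 1)^n], which cancels in the Gaussian binomials. *)
Definition qfact (n : nat) : K := \prod_(1 <= i < n.+1) (Q ^+ i - 1).

(** The Gaussian binomial through the q-Pascal rule, which needs no division. *)
Fixpoint gauss (n k : nat) : K :=
  match n, k with
  | _, 0%N => 1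
  | 0%N, _.+1 => 0
  | n'.+1, k'.+1 => gauss n' k' + Q ^+ k * gauss n' k
  end.

Lemma qfactS n : qfact n.+1 = qfact n * (Q ^+ n.+1 - 1).
Proof. by rewrite /qfact big_nat_recr. Qed.

Lemma qfact0 : qfact 0 = 1.
Proof. by rewrite /qfact big_geq. Qed.

Lemma gauss0r n : gauss n 0 = 1.
Proof. by case: n. Qed.

Lemma gauss_small n k : (n < k)%N -> gauss n k = 0.
Proof.
elim: n k => [|n IHn] [|k] //= nk.
by rewrite !IHn ?mulr0 ?addr0 // ltnW.
Qed.

Lemma gauss_qfact n k : (k <= n)%N ->
  gauss n k * (qfact k * qfact (n - k)) = qfact n.
Proof.
elim: n k => [|n IHn] [|k] // kn.
- by rewrite gauss0r qfact0 !mul1r.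
- by rewrite gauss0r qfact0 !mul1r subn0.
rewrite subSS /= !qfactS mulrDl.
have [nk|kn'] := leqP n k.
  have -> : k = n by apply/eqP; rewrite eqn_leq nk andbT.
  rewrite (gauss_small (ltnSn n)) mulr0 mul0r addr0.
  by rewrite -[in RHS](IHn n (leqnn n)); ring.
have := IHn k.+1 kn'; have := IHn k (ltnW kn').
rewrite -(subnSK kn') !qfactS => IH1 IH2.
(* The two Pascal terms add up by [Q^(n+1) - 1 = (Q^(k+1) - 1) + Q^(k+1) * (Q^(n-k) - 1)]. *)
transitivity (qfact n * (Q ^+ k.+1 - 1)
    + Q ^+ k.+1 * qfact n * (Q ^+ (n - k.+1).+1 - 1)).
  by rewrite -{1}IH1 -IH2; ring.
have -> : n.+1 = (k.+1 + (n - k.+1).+1)%N by lia.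
by rewrite exprD; ring.
Qed.

(** The q-binomial theorem. Under the q-Pascal rule, [gauss m b] accounts for the summand [y] of the
    new factor and [Q^(b+1) * gauss m (b+1)] for [Q^(m+1)]. *)
Lemma gauss_binomial (y : K) (m : nat) :
  \prod_(1 <= j < m.+1) (y + Q ^+ j) =
  \sum_(b < m.+1) gauss m b * Q ^+ 'C((m - b).+1, 2) * y ^+ b.
Proof.
elim: m => [|m IHm].
  by rewrite big_geq // big_ord1 /= bin_small // expr0 !mulr1.
rewrite big_nat_recr //= IHm mulrDr [in RHS]big_ord_recl gauss0r mul1r.
under [X in _ = _ + X]eq_bigr => b _ do
  rewrite lift0 /= subSS -!mulrA mulrDl -!mulrA.
rewrite big_split /= addrCA; congr (_ + _).
  by rewrite mulr_suml; apply: eq_bigr => b _; rewrite exprSr !mulrA.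
rewrite [X in _ = _ + X]big_ord_recr /= (gauss_small (ltnSn m)).
rewrite !(mulr0, mul0r) addr0.
rewrite big_ord_recl /= gauss0r mulrDl mul1r !subn0 !expr0 !mulr1.
rewrite [in RHS]binS bin1 [in RHS]exprD; congr (_ + _).
rewrite mulr_suml; apply: eq_bigr => b _.
rewrite -[bump 0 b]/(b.+1).
have -> : m.+1 = (b.+1 + (m - b.+1).+1)%N by have := ltn_ord b; lia.
rewrite -(subnSK (ltn_ord b)) [in RHS]binS bin1 !exprD; ring.
Qed.

End GaussianBinomials.

(** * Specialization to an integer q > 1 and evaluation of the double sum *)

Section RationalGauss.
Variable q : nat.
Hypothesis q_gt1 : (1 < q)%N.
Local Notation Q := (q%:R : rat).

Lemma expQ_gt1 i : 1 < Q ^+ i.+1.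
Proof. by rewrite exprn_egt1 // ltr1n. Qed.

Lemma Q_neq0 : Q != 0.
Proof. by rewrite pnatr_eq0 -lt0n ltnW. Qed.

Lemma qfact_neq0 n : qfact Q n != 0.
Proof.
elim: n => [|n IHn]; first by rewrite qfact0 oner_neq0.
by rewrite qfactS mulf_neq0 // subr_eq0 gt_eqF ?expQ_gt1.
Qed.

Lemma gauss_ratio n k : (k <= n)%N ->
  gauss Q n k = qfact Q n / (qfact Q k * qfact Q (n - k)).
Proof.
by move=> kn; rewrite -(gauss_qfact Q kn) mulfK // mulf_neq0 ?qfact_neq0.
Qed.

Lemma prod_top_qfact n c : (c <= n)%N ->
  (\prod_(i < c) (Q ^+ (n - i) - 1)) * qfact Q (n - c) = qfact Q n.
Proof.
elim: c => [|c IHc] cn; first by rewrite big_ord0 mul1r subn0.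
by rewrite big_ord_recr /= -(IHc (ltnW cn)) -(subnSK cn) qfactS; ring.
Qed.

Lemma qbinom_gauss n k : (k <= n)%N -> qbinom n k Q = gauss Q n k.
Proof.
move=> kn; transitivity
  (\prod_(1 <= i < k.+1) ((Q ^+ (n.+1 - i) - 1) / (Q ^+ i - 1))).
  by apply: eq_bigr => i _; rewrite -mulrNN -invrN !opprB.
rewrite prodf_div gauss_ratio // -(prod_top_qfact kn) -mulf_div.
rewrite divff ?qfact_neq0 // mulr1; congr (_ / _).
by rewrite big_add1 /= big_mkord.
Qed.

Lemma nfree_qfact n c : (c <= n)%N ->
  (nfree q n c)%:R = Q ^+ 'C(c, 2) * qfact Q n / qfact Q (n - c).
Proof.
move=> cn; rewrite -(prod_top_qfact cn) mulrA mulfK ?qfact_neq0 //.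
rewrite /nfree natr_prod.
have -> : Q ^+ 'C(c, 2) = \prod_(i < c) Q ^+ i.
  by rewrite -bin2_sum big_mkord prodrXr.
rewrite -big_split; apply: eq_bigr => i _ /=.
have le_in : (i <= n)%N by apply: leq_trans cn; apply: ltnW.
rewrite natrB ?leq_exp2l // !natrX mulrBr mulr1 -exprD subnKC //.
Qed.

(* L a b and S a r stand for the number of lattices of type (a, b) and of
   symmetric a x a matrices of rank r. *)
Lemma Delta_sum (n k : nat) (L S : nat -> nat -> nat) : (k <= n)%N ->
  (forall a b, (L a b * (nfree q a a * nfree q b b * q ^ (b * a)
      * q ^ ((a + b) * b)) = q ^ (n * b) * nfree q n (a + b))%N) ->
  (forall a r, (S a r * nfree q r r = nfree q a r * S r r)%N) ->
  (forall a, (\sum_(r < a.+1) S a r = q ^ 'C(a.+1, 2))%N) ->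
  Delta n k Q = \sum_(k <= a < n.+1) \sum_(0 <= b < (n - a).+1)
    (Q ^+ (b * (a + b + 1)) * (L a b)%:R * (S a (a - k)%N)%:R).
Proof.
move=> kn HL HS Hsum.
(* [HL] solved for [L a b], which carries [Q^(b(n-a-b))]; together with the weight [Q^(b(a+b+1))]
   this makes [Q^(b(n+1))]. *)
have LE a b : (a + b <= n)%N -> Q ^+ (b * (a + b + 1)) * (L a b)%:R =
    Q ^+ (b * n.+1) *
      (qfact Q n / (qfact Q a * qfact Q b * qfact Q (n - (a + b)))).
  move=> abn; have /(congr1 (fun m : nat => m%:R : rat)) := HL a b.
  rewrite !natrM !natrX !nfree_qfact // !subnn !qfact0 !divr1.
  have -> : 'C(a + b, 2) = ('C(a, 2) + 'C(b, 2) + b * a)%N.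
    elim: b {abn} => [|b IHb]; first by rewrite bin0n mul0n !addn0.
    by rewrite addnS !binS IHb !bin1; lia.
  rewrite !exprD => LE.
  have nzQ m : Q ^+ m != 0 by rewrite expf_neq0 ?Q_neq0.
  have nz : Q ^+ 'C(a, 2) * qfact Q a * (Q ^+ 'C(b, 2) * qfact Q b) *
    Q ^+ (b * a) * Q ^+ ((a + b) * b) != 0 by rewrite !mulf_neq0 ?qfact_neq0.
  apply: (mulIf nz); rewrite -[LHS]mulrA LE.
  have expE : Q ^+ (b * (a + b + 1)) * Q ^+ (n * b) =
      Q ^+ (b * n.+1) * Q ^+ ((a + b) * b).
    by rewrite -!exprD; congr (_ ^+ _); lia.
  rewrite [LHS]mulrA expE.
  move: (Q ^+ (b * n.+1)) (Q ^+ ((a + b) * b)) (Q ^+ (b * a)).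
  by move=> x y z; field; rewrite !qfact_neq0.
have SE a r : (r <= a)%N -> (S a r)%:R = gauss Q a r * (S r r)%:R.
  move=> ra; have /(congr1 (fun m : nat => m%:R : rat)) := HS a r.
  rewrite !natrM !nfree_qfact // subnn qfact0 divr1 gauss_ratio // => SE.
  have nz : Q ^+ 'C(r, 2) * qfact Q r != 0.
    by rewrite mulf_neq0 ?expf_neq0 ?Q_neq0 ?qfact_neq0.
  apply: (mulIf nz); rewrite SE; field.
  by rewrite !qfact_neq0.
pose m := (n - k)%N; pose y := Q ^+ n.+1.
(* With [a = s + k], the factor [qfact (s + k)] cancels, and the remaining multinomial regroups so
   that [gauss m-b s] is absorbed into [S (m - b) s]. *)
have TE s b : (s + b <= m)%N ->
    Q ^+ (b * (s + k + b + 1)) * (L (s + k) b)%:R * (S (s + k) s)%:R =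
    gauss Q n k * (gauss Q m b * y ^+ b * (S (m - b)%N s)%:R).
  move=> sbm; have kbn : (s + k + b <= n)%N by lia.
  have [smb bm] : (s <= m - b)%N /\ (b <= m)%N by lia.
  rewrite LE // (SE _ _ (leq_addr k s)) (SE _ _ smb).
  rewrite !gauss_ratio ?leq_addr //.
  have -> : (s + k - s = k)%N by lia.
  have -> : (n - (s + k + b) = m - b - s)%N by lia.
  rewrite -/m mulnC exprM -/y; field.
  by rewrite !qfact_neq0.
(* Both indices get the fixed range [m.+1], the triangle [s + b <= m] being kept as a condition, so
   that the sums can be exchanged. *)
transitivity (\sum_(s < m.+1) \sum_(b < m.+1 | (b < (m - s).+1)%N)
    gauss Q n k * (gauss Q m b * y ^+ b * (S (m - b)%N s)%:R)); last first.
  rewrite [RHS](big_addn 0 n.+1 k) subSn // -/m big_mkord.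
  apply: eq_bigr => s _; have -> : (n - (s + k) = m - s)%N by lia.
  rewrite big_mkord (big_ord_widen m.+1 (fun b => Q ^+ (b * (s + k + b + 1))%N *
    (L (s + k)%N b)%:R * (S (s + k)%N (s + k - k)%N)%:R)) ?ltnS ?leq_subr //.
  by apply: eq_bigr => b bms; rewrite addnK TE //; have := ltn_ord s; lia.
rewrite (exchange_big_dep xpredT) //=.
transitivity (gauss Q n k * \prod_(1 <= j < m.+1) (y + Q ^+ j)).
  rewrite /Delta qbinom_gauss // mulrC mulrA [X in _ = X]mulrC -/m.
  congr (_ * _); rewrite addn1.
  (* The prefactor supplies one [Q^j] for each [j]; it meets the factor of index [m + 1 - j], and
     [Q^j * (1 + Q^(k+m+1-j)) = Q^j + y] because [k + m = n]. *)
  have -> : 'C(m.+1, 2) = (\sum_(1 <= j < m.+1) j)%N.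
    by rewrite -bin2_sum big_ltn.
  rewrite -prodrXr [X in X * _]big_nat_rev -big_split.
  apply: eq_big_nat => j /andP[j_gt0 jm] /=.
  rewrite mulrDl mul1r -exprD addrC /y; congr (_ + _); congr (_ ^+ _); lia.
rewrite gauss_binomial mulr_sumr; apply: eq_bigr => b _.
rewrite -mulr_sumr -mulr_sumr; congr (_ * _).
(* For fixed [b] the rank [s] runs over [0, ..., m - b], so [Hsum] evaluates the inner sum. *)
rewrite mulrAC; congr (_ * _); rewrite -natr_sum -natrX -Hsum.
congr (_%:R).
rewrite (big_ord_widen m.+1 (fun s => S (m - b)%N s)) ?ltnS ?leq_subr //.
by apply: eq_bigl => s; have := ltn_ord s; have := ltn_ord b; lia.
Qed.
End RationalGauss.

(** * Quotient modules and the residue field *)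

Local Open Scope classical_set_scope.

Section QuotientMap.
Variables (R : nzRingType) (V : lmodType R) (S : submodClosed V).

Definition qpi (v : V) : quotmod S := \pi_(quotmod S)%qT v.
Definition qrepr (x : quotmod S) : V := generic_quotient.repr x.

Lemma qpi_linear : linear qpi.
Proof. by move=> c u v; rewrite /qpi quotmod_piD -quotmod_scale_pi. Qed.

HB.instance Definition _ :=
  GRing.isLinear.Build R V (quotmod S) _ qpi qpi_linear.

Lemma qreprK : cancel qrepr qpi.
Proof. exact: generic_quotient.reprK. Qed.

Lemma qpi_eq0 v : qpi v = 0 <-> v \in S.
Proof.
split=> [v0|vS].
  have := Quotient.idealrBE (submod_zmod S) v 0.
  rewrite subr0 => vE; change (v \in submod_zmod S); rewrite vE.
  by apply/eqP; rewrite -[LHS]/(qpi v) v0 -(linear0 qpi).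
rewrite -(linear0 qpi); apply: quotmod_piE; by rewrite subr0.
Qed.

Lemma qpi_eq u v : qpi u = qpi v <-> u - v \in S.
Proof.
rewrite -qpi_eq0 linearB /=; split=> [->|/eqP]; first by rewrite subrr.
by rewrite subr_eq0 => /eqP.
Qed.

(** First isomorphism theorem: [f] applied to representatives is well defined, since [S] is its
    kernel. *)
Lemma lmod_isom_quotmod (E : lmodType R) (f : {linear V -> E}) :
  (forall v, f v = 0 <-> v \in S) -> (forall e, exists v, f v = e) ->
  lmod_isom (quotmod S) E.
Proof.
move=> f0 fsurj.
have f_eq u v : qpi u = qpi v -> f u = f v.
  move=> /qpi_eq/f0/eqP; by rewrite linearB subr_eq0 => /eqP.
pose g x := f (qrepr x).
have gpi v : g (qpi v) = f v by apply: f_eq; rewrite qreprK.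
have g_lin : linear g.
  by move=> c x y; rewrite -(qreprK x) -(qreprK y) -linearP !gpi linearP.
pose h : {linear quotmod S -> E} := HB.pack g
  (GRing.isLinear.Build R (quotmod S) E _ g g_lin).
have [s sK] := choice fsurj; exists h; exists (qpi \o s) => [x|e] /=.
  by rewrite -[RHS]qreprK; apply/qpi_eq/f0; rewrite linearB sK subrr.
by rewrite /h /= gpi sK.
Qed.

End QuotientMap.

(** * The residue ring o/p as a finite field *)

Section ResidueField.
Variables (o : comNzRingType) (p : submodClosed o^o).

(* The proofs are arguments of the type only to let the field and finiteness
   instances on it depend on them. *)
Definition residue of maximal_ideal p & finite_set [set: quotmod p] : Type :=
  quotmod p.

Variables (pmax : maximal_ideal p) (pfin : finite_set [set: quotmod p]).
Local Notation K := (residue pmax pfin).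

HB.instance Definition _ := GRing.Zmodule.on K.

Definition to_residue (x : o) : K := qpi p x.
Definition of_residue (x : K) : o := qrepr x.

Lemma of_residueK : cancel of_residue to_residue.
Proof. exact: qreprK. Qed.

Lemma to_residue_eq x y : to_residue x = to_residue y <-> (x - y : o^o) \in p.
Proof. exact: qpi_eq. Qed.

Lemma to_residue_eq0 x : to_residue x = 0 <-> (x : o^o) \in p.
Proof. exact: qpi_eq0. Qed.

Lemma to_residue_is_additive : zmod_morphism to_residue.
Proof. exact: (linearB (qpi p)). Qed.

Definition residue_one : K := to_residue 1.
Definition residue_mul (x y : K) : K :=
  to_residue (of_residue x * of_residue y).

Lemma to_residueM x y :
  to_residue (x * y) = residue_mul (to_residue x) (to_residue y).
Proof.
apply/esym/to_residue_eq.
set x' := of_residue _; set y' := of_residue _.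
have -> : x' * y' - x * y = x' * (y' - y) + y * (x' - x) by ring.
by apply: rpredD; apply: rpredZ; apply/to_residue_eq; rewrite of_residueK.
Qed.

Lemma residue_mulA : associative (@residue_mul).
Proof.
move=> x y z; rewrite -[x]of_residueK -[y]of_residueK -[z]of_residueK.
by rewrite -!to_residueM mulrA.
Qed.

Lemma residue_mulC : commutative (@residue_mul).
Proof. by move=> x y; rewrite /residue_mul mulrC. Qed.

Lemma residue_mul1 : left_id residue_one residue_mul.
Proof. by move=> x; rewrite -[x]of_residueK -to_residueM mul1r. Qed.

Lemma residue_mulDl : left_distributive residue_mul +%R.
Proof.
have toD x y : to_residue x + to_residue y = to_residue (x + y).
  exact/esym/(linearD (qpi p)).
move=> x y z; rewrite -[x]of_residueK -[y]of_residueK -[z]of_residueK.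
by rewrite toD -!to_residueM toD mulrDl.
Qed.

Lemma residue_one_neq0 : residue_one != 0.
Proof.
by apply/eqP => /to_residue_eq0; apply/negP; case: pmax.
Qed.

HB.instance Definition _ := GRing.Zmodule_isComNzRing.Build K
  residue_mulA residue_mulC residue_mul1 residue_mulDl residue_one_neq0.

Lemma to_residue_is_multiplicative : monoid_morphism to_residue.
Proof. by split=> // x y; apply: to_residueM. Qed.

HB.instance Definition _ := GRing.isZmodMorphism.Build o K to_residue
  to_residue_is_additive.
HB.instance Definition _ := GRing.isMonoidMorphism.Build o K to_residue
  to_residue_is_multiplicative.

Section AddElement.
Variable x : o.

Definition ideal_add_pred : o^o -> bool := fun y =>
  `[< exists m c, (m : o^o) \in p /\ y = m + c * x >].

Lemma ideal_add_closed : submod_closed ideal_add_pred.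
Proof.
split; first by apply/asboolP; exists 0, 0; rewrite rpred0 mul0r addr0.
move=> c _ _ /asboolP[m [d [mp ->]]] /asboolP[m' [d' [mp' ->]]].
apply/asboolP; exists (c * m + m'), (c * d + d'); split.
  by apply: rpredD => //; apply: (rpredZ (c : o)).
by rewrite mulrDl addrACA -mulrA -mulrDr.
Qed.

HB.instance Definition _ :=
  GRing.isSubmodClosed.Build o o^o ideal_add_pred ideal_add_closed.

Definition ideal_add : submodClosed o^o :=
  GRing.SubmodClosed.clone o o^o ideal_add_pred _.

End AddElement.

(** If the ideal generated by [p] and a representative of [x] contains 1, the coefficient of that
    representative is an inverse; otherwise maximality puts the representative in [p]. *)
Lemma residue_inv_exists (x : K) : x != 0 -> exists y : K, y * x = 1.
Proof.
move=> x0; pose J := ideal_add (of_residue x).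
have [_ maxp] := pmax.
have [/asboolP[m [c [mp oneE]]]|J1] := boolP ((1 : o^o) \in J).
  exists (to_residue c); rewrite -[x]of_residueK -[LHS]to_residueM.
  apply/to_residue_eq; suff -> : c * of_residue x - 1 = (-1) *: (m : o^o).
    exact: rpredZ.
  by rewrite scaleN1r oneE opprD addrCA subrr addr0.
have pJ : {subset p <= J}.
  by move=> m mp; apply/asboolP; exists m, 0; rewrite mul0r addr0.
have xJ : (of_residue x : o^o) \in J.
  by apply/asboolP; exists 0, 1; rewrite rpred0 mul1r add0r.
move: x0; rewrite -[x]of_residueK => /eqP[].
by apply/to_residue_eq0; rewrite -(maxp J).
Qed.

(** The default 0 of [xget] is the value that a field structure prescribes for the inverse of 0. *)
Definition residue_inv (x : K) : K := xget 0 [set y | y * x = 1].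

Lemma residue_mulVf (x : K) : x != 0 -> residue_inv x * x = 1.
Proof. by move=> /residue_inv_exists; apply: xgetPex. Qed.

Lemma residue_inv0 : residue_inv 0 = 0.
Proof.
apply: xgetPN => y /eqP; apply/negP.
by rewrite mulr0 eq_sym oner_neq0.
Qed.

HB.instance Definition _ :=
  GRing.ComNzRing_isField.Build K residue_mulVf residue_inv0.

Definition residue_enum : seq K := fset_set [set: quotmod p].

Lemma mem_residue_enum (x : K) : x \in residue_enum.
Proof.
have : (x : quotmod p) \in fset_set [set: quotmod p]; last by [].
by rewrite in_fset_set ?inE.
Qed.

Lemma residue_pickleK :
  pcancel (fun x : K => index x residue_enum) (onth residue_enum).
Proof.
move=> x; rewrite onthE (nth_map x) ?index_mem ?mem_residue_enum //.
by rewrite nth_index ?mem_residue_enum.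
Qed.

HB.instance Definition _ := PCanIsCountable residue_pickleK.

Lemma residue_enumP : Finite.axiom residue_enum.
Proof.
move=> x; rewrite count_uniq_mem ?mem_residue_enum //.
exact: (@fset_uniq _ (fset_set [set: quotmod p])).
Qed.

HB.instance Definition _ := fintype.isFinite.Build K residue_enumP.

Lemma card_residue (q : nat) : ([set: quotmod p] #= `I_q)%card -> #|{: K}| = q.
Proof.
by move=> /card_fset_set <-; rewrite cardT enumT unlock.
Qed.

Definition residue_field : finFieldType := K.

End ResidueField.
Section KernelSubmodule.
Variables (R : nzRingType) (V E : lmodType R) (f : {linear V -> E}).

Definition ker_pred : V -> bool := fun v => f v == 0.

Lemma ker_closed : submod_closed ker_pred.
Proof.
split=> [|c u v /eqP u0 /eqP v0]; first by apply/eqP; rewrite linear0.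
by apply/eqP; rewrite linearP u0 v0 scaler0 addr0.
Qed.

HB.instance Definition _ :=
  GRing.isSubmodClosed.Build R V ker_pred ker_closed.

Definition ker_submod : submodClosed V :=
  GRing.SubmodClosed.clone R V ker_pred _.

Lemma ker_submodP v : reflect (f v = 0) (v \in ker_submod).
Proof. exact: eqP. Qed.

End KernelSubmodule.

(** * Surjections onto a module of type (a, b) *)

Section LengthTwoModules.
(** [phi] is reduction modulo [p], [sigma] a merely set-theoretic section of it, and [pi] a
    generator of [p]. [std] presents [E] as the quotient of [o^(a+b)] by [pi o^a + pi^2 o^b]. *)
Variables (o : idomainType) (F : finFieldType) (phi : {rmorphism o -> F}).
Variables (sigma : F -> o) (pi : o).
Hypotheses (sigmaK : cancel sigma phi) (pi_neq0 : pi != 0).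
Hypothesis phi_pi : phi pi = 0.
Hypothesis phi_eq0 : forall x, phi x = 0 -> exists c, x = pi * c.
Variables (a b : nat) (E : lmodType o) (std : {linear 'rV[o]_(a + b) -> E}).
Hypothesis std_surj : forall e, exists v, std v = e.
Hypothesis std_eq0 : forall v, std v = 0 <->
  exists w1 w2, v = row_mx (pi *: w1) (pi ^+ 2 *: w2).

(* An N-tuple in E is encoded by its residues t.1 and by the second digits t.2
   of its components in o/p^2; std maps the rows of the matrix below to it. *)
Definition lift_mx (N : nat) (t : 'M[F]_(N, a + b) * 'M[F]_(N, b)) :
    'M[o]_(N, a + b) :=
  map_mx sigma t.1 + pi *: row_mx 0 (map_mx sigma t.2).

Lemma map_phi_sigma m n (X : 'M[F]_(m, n)) : map_mx phi (map_mx sigma X) = X.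
Proof. by apply/matrixP=> i j; rewrite !mxE sigmaK. Qed.

Lemma map_phi_pi m n (X : 'M[o]_(m, n)) : map_mx phi (pi *: X) = 0.
Proof. by rewrite map_mxZ phi_pi scale0r. Qed.

Lemma map_phi_eq0 m n (X : 'M[o]_(m, n)) : map_mx phi X = 0 ->
  exists Y, X = pi *: Y.
Proof.
move=> /matrixP X0.
have /fin_all_exists[f fE] (ij : 'I_m * 'I_n) : exists c, X ij.1 ij.2 = pi * c.
  by apply: phi_eq0; have := X0 ij.1 ij.2; rewrite !mxE.
exists (\matrix_(i, j) f (i, j)); apply/matrixP=> i j.
by rewrite !mxE -(fE (i, j)).
Qed.

Lemma map_phi_eq m n (X Y : 'M[o]_(m, n)) : map_mx phi X = map_mx phi Y ->
  exists Z, X = Y + pi *: Z.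
Proof.
move=> XY; have [Z XYZ] : exists Z, X - Y = pi *: Z.
  by apply: map_phi_eq0; rewrite map_mxB XY subrr.
by exists Z; rewrite -XYZ addrC subrK.
Qed.

Lemma map_phi_lift N (t : 'M[F]_(N, a + b) * 'M[F]_(N, b)) :
  map_mx phi (lift_mx t) = t.1.
Proof. by rewrite map_mxD map_phi_pi addr0 map_phi_sigma. Qed.

Lemma scale_pi_inj m n : injective (fun X : 'M[o]_(m, n) => pi *: X).
Proof.
move=> X Y /matrixP XY; apply/matrixP=> i j; apply: (mulfI pi_neq0).
by have := XY i j; rewrite !mxE.
Qed.

Lemma std_pi2 v : std (pi ^+ 2 *: v) = 0.
Proof.
apply/std_eq0; exists (pi *: lsubmx v), (rsubmx v).
by rewrite scalerA -expr2 -scale_row_mx hsubmxK.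
Qed.

Lemma std_eq0_phi v : std v = 0 -> map_mx phi v = 0.
Proof.
move=> /std_eq0[w1 [w2 ->]].
by rewrite map_row_mx expr2 -scalerA !map_phi_pi row_mx0.
Qed.

Lemma std_eq_phi v w : std v = std w -> map_mx phi v = map_mx phi w.
Proof.
move=> vw; apply/eqP; rewrite -subr_eq0 -map_mxB; apply/eqP/std_eq0_phi.
by rewrite linearB /= vw subrr.
Qed.

(** Multiplication by [pi] kills the [o/p] part of [E] and sees only the residues of the [o/p^2]
    part. *)
Lemma std_pi_eq0 v : std (pi *: v) = 0 <-> map_mx phi (rsubmx v) = 0.
Proof.
split=> [/std_eq0[w1 [w2]]|].
  rewrite -{1}(hsubmxK v) scale_row_mx => /eq_row_mx[_].
  by rewrite expr2 -scalerA => /scale_pi_inj ->; exact: map_phi_pi.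
move=> /map_phi_eq0[w vw]; apply/std_eq0; exists (lsubmx v), w.
by rewrite -{1}(hsubmxK v) scale_row_mx vw scalerA expr2.
Qed.

(** One [pi]-adic digit in the first [a] columns and two in the last [b] determine the image in [E];
    the remainder lies in the kernel of [std]. *)
Lemma std_mul_lift N (W : 'M[o]_(N, a + b)) :
  exists t, forall v, std (v *m W) = std (v *m lift_mx t).
Proof.
have [B WB] : exists B, W = map_mx sigma (map_mx phi W) + pi *: B.
  by apply: map_phi_eq; rewrite map_phi_sigma.
have [C BC] : exists C,
    rsubmx B = map_mx sigma (map_mx phi (rsubmx B)) + pi *: C.
  by apply: map_phi_eq; rewrite map_phi_sigma.
exists (map_mx phi W, map_mx phi (rsubmx B)) => v.
apply/eqP; rewrite -subr_eq0 -linearB -mulmxBr; apply/eqP/std_eq0.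
exists (v *m lsubmx B), (v *m C).
rewrite !scalemxAr -mul_mx_row; congr (_ *m _).
rewrite /lift_mx /= {1}WB opprD addrACA subrr add0r -scalerBr.
have -> : B - row_mx 0 (map_mx sigma (map_mx phi (rsubmx B))) =
    row_mx (lsubmx B) (pi *: C).
  rewrite -{1}(hsubmxK B) opp_row_mx add_row_mx oppr0 addr0 {1}BC.
  by rewrite addrAC subrr add0r.
by rewrite scale_row_mx scalerA expr2.
Qed.

Lemma hom_lift N (g : {linear 'rV[o]_N -> E}) :
  exists t, forall v, g v = std (v *m lift_mx t).
Proof.
have /fin_all_exists[w wE] (i : 'I_N) : exists w, std w = g (delta_mx 0 i).
  exact: std_surj.
have [t tE] := std_mul_lift (\matrix_i w i); exists t => v.
rewrite -tE mulmx_sum_row {1}(row_sum_delta v) !linear_sum.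
by apply: eq_bigr => i _; rewrite !linearZ rowK /= wE.
Qed.

(** With [hom_lift], the codes [t] correspond one to one to the linear maps
    [f_t : v |-> std (v *m lift_mx t)]. Residues are compared first; then the difference is [pi]
    times that of the second digits. *)
Lemma lift_inj N (t t' : 'M[F]_(N, a + b) * 'M[F]_(N, b)) :
  (forall v, std (v *m lift_mx t) = std (v *m lift_mx t')) -> t = t'.
Proof.
move=> tt'.
have XX' : t.1 = t'.1.
  apply/row_matrixP => i; rewrite -!map_phi_lift -!map_row !rowE.
  exact/std_eq_phi/tt'.
suff ZZ' : t.2 = t'.2 by move: XX' ZZ'; case: (t) (t') => ? ? [? ?] /= -> ->.
apply/row_matrixP => i.
have /eqP := tt' (delta_mx 0 i).
rewrite -subr_eq0 -linearB -mulmxBr /lift_mx XX' opprD addrACA subrr add0r.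
rewrite -scalerBr -scalemxAr.
move=> /eqP/std_pi_eq0; rewrite opp_row_mx add_row_mx mul_mx_row row_mxKr.
move=> /eqP; rewrite map_mxM map_mxB !map_phi_sigma mulmxBr subr_eq0 => /eqP.
by rewrite map_delta_mx -!rowE.
Qed.

(* Nakayama's lemma for E, whose radical pi E has square zero. *)
Lemma lift_surj N (t : 'M[F]_(N, a + b) * 'M[F]_(N, b)) :
  (forall e, exists v, std (v *m lift_mx t) = e) <-> row_full t.1.
Proof.
split=> [surj|full].
  rewrite -sub1mx; apply/row_subP => i.
  have [v /std_eq_phi] := surj (std (map_mx sigma (row i 1%:M))).
  by rewrite map_mxM map_phi_lift map_phi_sigma => <-; apply: submxMl.
have approx (w : 'rV[o]_(a + b)) : exists v w', w = v *m lift_mx t + pi *: w'.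
  have [u uE] : exists u, map_mx phi w = u *m t.1.
    by apply/submxP/submx_full.
  exists (map_mx sigma u); apply: map_phi_eq.
  by rewrite map_mxM map_phi_lift map_phi_sigma.
move=> e; have [w <-] := std_surj e.
have [v [w' ->]] := approx w; have [v' [w'' ->]] := approx w'.
exists (v + pi *: v'); rewrite mulmxDl -scalemxAl scalerDr scalerA -expr2 addrA.
by rewrite [RHS]linearD /= std_pi2 addr0.
Qed.

Definition same_ker N (t t' : 'M[F]_(N, a + b) * 'M[F]_(N, b)) : bool :=
  `[< forall v, std (v *m lift_mx t) = 0 <-> std (v *m lift_mx t') = 0 >].

(* If s is a section of the surjection f_t then f_u |-> f_u o s o f_t1 maps the
   u with the kernel of f_t injectively to those with the kernel of f_t1. *)
Lemma leq_card_same_ker N M (t : 'M[F]_(N, a + b) * 'M[F]_(N, b))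
    (t1 : 'M[F]_(M, a + b) * 'M[F]_(M, b)) : row_full t.1 -> row_full t1.1 ->
  (#|[set u | row_full u.1 && same_ker u t]%SET| <=
   #|[set u | row_full u.1 && same_ker u t1]%SET|)%N.
Proof.
move=> /lift_surj surj /lift_surj surj1.
have [s sK] := choice surj.
have sameE u v w : same_ker u t ->
    std (v *m lift_mx t) = std (w *m lift_mx t) ->
    std (v *m lift_mx u) = std (w *m lift_mx u).
  move=> /asboolP ut vw; apply/eqP; rewrite -subr_eq0 -linearB -mulmxBl.
  by apply/eqP/ut; rewrite mulmxBl linearB /= vw subrr.
pose transfer u v := std (s (std (v *m lift_mx t1)) *m lift_mx u).
have /fin_all_exists[f fE] u : exists u1, same_ker u t ->
    forall v, transfer u v = std (v *m lift_mx u1).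
  have [ut|_] := boolP (same_ker u t); last by exists t1.
  (* The section [s] need not be linear, but its composite with [f_u] is: [f_u] takes equal values
     at any two preimages under [f_t]. *)
  have tr_lin : linear (transfer u).
    move=> c v w; rewrite /transfer -linearP /=.
    rewrite scalemxAl -mulmxDl; apply: sameE => //.
    by rewrite sK !mulmxDl -!scalemxAl !linearP /= !sK.
  pose g : {linear 'rV[o]_M -> E} := HB.pack (transfer u)
    (GRing.isLinear.Build o _ _ _ (transfer u) tr_lin).
  by have [u1 u1E] := hom_lift g; exists u1 => _; apply: u1E.
have f_inj : {in [set u | row_full u.1 && same_ker u t]%SET &, injective f}.
  move=> u u'; rewrite !inE => /andP[_ ut] /andP[_ ut'] uu'.
  apply: lift_inj => v.
  have [w wE] := surj1 (std (v *m lift_mx t)).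
  have trE x : same_ker x t -> std (v *m lift_mx x) = transfer x w.
    by move=> xt; apply: sameE => //; rewrite sK wE.
  by rewrite !trE // !fE // uu'.
rewrite -(card_in_imset f_inj).
apply/subset_leq_card/fintype.subsetP => _ /imsetP[u + ->].
rewrite !inE => /andP[/lift_surj fu ut]; apply/andP; split.
  apply/lift_surj => e; have [v <-] := fu e.
  have [w wE] := surj1 (std (v *m lift_mx t)).
  by exists w; rewrite -fE //; apply: sameE => //; rewrite sK wE.
have /asboolP utP := ut.
by apply/asboolP => v; rewrite -fE // utP sK.
Qed.

(** All kernel classes have the same size, so [t] may be replaced by the code [t1] of [std] itself.
    The maps with the kernel of [std] are those inducing automorphisms of [E], which shows in the
    residues [u.1] alone. *)
Lemma card_same_ker N (t : 'M[F]_(N, a + b) * 'M[F]_(N, b)) : row_full t.1 ->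
  #|[set u | row_full u.1 && same_ker u t]%SET| =
  #|[set u : 'M[F]_(a + b) * 'M[F]_(a + b, b) |
      row_free u.1 && (ursubmx u.1 == 0)]%SET|.
Proof.
move=> full.
have [t1 t1E] := std_mul_lift 1%:M.
have {}t1E v : std v = std (v *m lift_mx t1) by rewrite -t1E mulmx1.
have full1 : row_full t1.1.
  by apply/lift_surj => e; have [v <-] := std_surj e; exists v.
transitivity #|[set u | row_full u.1 && same_ker u t1]%SET|.
  by apply/eqP; rewrite eqn_leq !leq_card_same_ker.
apply: eq_card => u; rewrite !inE row_free_unit -row_full_unit.
have [fullu|] //= := boolP (row_full u.1).
apply/asboolP/eqP => [ker|ur0 v]; last rewrite -t1E.
  have urE : ursubmx u.1 = map_mx phi (rsubmx (usubmx (lift_mx u))).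
    by rewrite map_rsubmx map_usubmx map_phi_lift.
  rewrite urE; apply/row_matrixP => i; rewrite -map_row row0.
  have -> : row i (rsubmx (usubmx (lift_mx u))) =
      rsubmx (row i (usubmx (lift_mx u))).
    by apply/rowP => j; rewrite !mxE.
  rewrite rowE.
  apply/std_pi_eq0.
  (* [std] kills [pi] times each of the first [a] basis vectors, hence so does [f_u]; this forces
     the upper right block of the residues to vanish. *)
  have := ker (pi *: row_mx (delta_mx 0 i) 0); rewrite -t1E.
  rewrite -scalemxAl -{1}(vsubmxK (lift_mx u)) mul_row_col mul0mx addr0.
  case=> _ -> //.
  by apply/std_pi_eq0; rewrite row_mxKr map_mx0.
have phiM w : map_mx phi (rsubmx (w *m lift_mx u)) =
    map_mx phi (rsubmx w) *m drsubmx u.1.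
  rewrite map_rsubmx map_mxM map_phi_lift -{1}(hsubmxK w) map_row_mx.
  by rewrite -{1}(submxK u.1) ur0 mul_row_block row_mxKr mulmx0 add0r.
have freeu : row_free u.1 by rewrite row_free_unit -row_full_unit.
split.
  (* Invertibility of [u.1] gives [v = pi *: w]; invertibility of its lower right block then kills
     the last [b] residues of [w]. *)
  move=> v0; have := std_eq0_phi v0.
  rewrite map_mxM map_phi_lift => vX0.
  have [w vw] : exists w, v = pi *: w.
    by apply: map_phi_eq0; apply: (row_free_inj freeu); rewrite mul0mx.
  rewrite vw; apply/std_pi_eq0.
  move: v0; rewrite vw -scalemxAl => /std_pi_eq0; rewrite phiM => w0.
  suff freed : row_free (drsubmx u.1).
    by apply: (row_free_inj freed); rewrite mul0mx.
  move: freeu; rewrite !row_free_unit !unitmxE.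
  by rewrite -{1}(submxK u.1) ur0 det_lblock unitrM => /andP[].
move=> /std_eq0[w1 [w2 ->]].
have -> : row_mx (pi *: w1) (pi ^+ 2 *: w2) = pi *: row_mx w1 (pi *: w2).
  by rewrite scale_row_mx scalerA expr2.
rewrite -scalemxAl; apply/std_pi_eq0.
by rewrite phiM row_mxKr map_phi_pi mul0mx.
Qed.

End LengthTwoModules.

(** * Counting lattices *)

(** Applied to the map sending a surjection to its kernel, whose fibres all have the size of the
    automorphism group. *)
Lemma ncard_image_fibre (T : finType) (X : choiceType) (K : T -> X)
    (A : {set T}) (N : nat) :
  (forall t, t \in A -> #|[set u in A | K u == K t]%SET| = N) ->
  #|A| = (ncard (K @` [set` A]) * N)%N.
Proof.
move=> fibre; have Kfin := finite_image K (finite_finset (X := [set` A])).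
rewrite /ncard; set Y := fset_set _.
have KY t : t \in A -> K t \in Y.
  by move=> tA; rewrite in_fset_set // inE; exists t.
have -> : (#|` Y| * N = \sum_(y <- Y) N)%N.
  by rewrite big_const_seq count_predT iter_addn_0 mulnC.
transitivity (\sum_(t in A) \sum_(y <- Y | K t == y) 1)%N.
  rewrite -sum1_card; apply: eq_bigr => t /KY tY.
  rewrite sum1_count (eq_count (a2 := pred1 (K t))); last first.
    by move=> y; rewrite /= eq_sym.
  by rewrite count_uniq_mem ?fset_uniq // tY.
rewrite (exchange_big_dep xpredT) //= big_seq [RHS]big_seq.
apply: eq_bigr => y; rewrite in_fset_set // inE => -[t tA <-].
by rewrite -(fibre t tA) -sum1_card; apply: eq_bigl => u; rewrite inE.
Qed.

Lemma principal_generator (o : idomainType) (p : submodClosed o^o) : is_dvr p ->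
  exists2 pi : o, pi != 0 &
    forall x : o, (x : o^o) \in p <-> exists c, x = pi * c.
Proof.
move=> dvr; have [pi piE] := dvr_pid dvr p.
have [x /piE[c ->] x0] := dvr_not_field dvr.
exists pi; first by apply: contraNneq x0 => ->; rewrite mulr0.
by move=> y; rewrite piE; split=> -[d ->]; exists d; rewrite mulrC.
Qed.

(** * The standard presentation of the module of type (a, b) *)

Section ElementaryModule.
Variables (o : idomainType) (p : submodClosed o^o) (pi : o).
Hypothesis pE : forall x : o, (x : o^o) \in p <-> exists c, x = pi * c.

Lemma mem_ideal_pow2 (x : o) :
  (x : o^o) \in ideal_pow p 2 <-> exists c, x = pi ^+ 2 * c.
Proof.
split=> [/asboolP[s [sp ->]]|[c ->]].
  elim: s sp => [|u s IHs] sp; first by exists 0; rewrite big_nil mulr0.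
  have [c sE] : exists c, \sum_(u <- s) (u.1 : o) * u.2 = pi ^+ 2 * c.
    by apply: IHs => v vs; apply: sp; rewrite inE vs orbT.
  have [/pE[d1 u1E] /pE[d2 u2E]] := sp u (mem_head _ _).
  exists (d1 * d2 + c); rewrite big_cons.
  have -> : (u.1 : o) * u.2 = (pi * d1) * (pi * d2) by rewrite -u1E -u2E.
  by rewrite sE; ring.
apply/asboolP; exists [:: (pi : o^o, pi * c : o^o)]; split.
  move=> u; rewrite inE => /eqP -> /=; split; apply/pE; last by exists c.
  by exists 1; rewrite mulr1.
by rewrite big_seq1 /= mulrA expr2.
Qed.

Variables a b : nat.
Local Notation E := (elem_mod p a b).

Definition std (v : 'rV[o]_(a + b)) : E :=
  ([ffun i => qpi p (v 0 (lshift b i) : o^o)],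
   [ffun j => qpi (ideal_pow p 2) (v 0 (rshift a j) : o^o)]).

Lemma std_linear : linear std.
Proof.
move=> c u v; congr pair; apply/ffunP=> i; rewrite !ffunE !mxE.
  exact: (linearP (qpi p) c (u 0 _ : o^o)).
exact: (linearP (qpi (ideal_pow p 2)) c (u 0 _ : o^o)).
Qed.

HB.instance Definition _ := GRing.isLinear.Build o _ E _ std std_linear.

Lemma std_surj e : exists v, std v = e.
Proof.
case: e => x y.
exists (row_mx (\row_i qrepr (x i)) (\row_j qrepr (y j))).
congr pair; apply/ffunP=> i; rewrite ffunE.
  by rewrite row_mxEl mxE qreprK.
by rewrite row_mxEr mxE qreprK.
Qed.

Lemma std_eq0 v : std v = 0 <->
  exists w1 w2, v = row_mx (pi *: w1) (pi ^+ 2 *: w2).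
Proof.
split=> [v0|[w1 [w2 ->]]]; last first.
  congr pair; apply/ffunP=> i; rewrite !ffunE.
    by rewrite row_mxEl mxE; apply/qpi_eq0/pE; exists (w1 0 i).
  by rewrite row_mxEr mxE; apply/qpi_eq0/mem_ideal_pow2; exists (w2 0 i).
have /fin_all_exists[w1 w1E] (i : 'I_a) : exists c, v 0 (lshift b i) = pi * c.
  apply/pE/qpi_eq0; have /ffunP/(_ i) := congr1 fst v0.
  by rewrite !ffunE.
have /fin_all_exists[w2 w2E] (j : 'I_b) :
    exists c, v 0 (rshift a j) = pi ^+ 2 * c.
  apply/mem_ideal_pow2/qpi_eq0; have /ffunP/(_ j) := congr1 snd v0.
  by rewrite !ffunE.
exists (\row_i w1 i), (\row_j w2 j); rewrite -[LHS]hsubmxK.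
by congr row_mx; apply/rowP=> i; rewrite !mxE ?w1E ?w2E.
Qed.

End ElementaryModule.

(** The right-hand side counts the surjections [o^n -> E]: residues of full rank and [q^(n b)] free
    choices of second digits. The parenthesized factor on the left is the number of surjections
    sharing a kernel. *)
Lemma card_calL (o : idomainType) (p : submodClosed o^o) (q n a b : nat) :
  is_dvr p -> ([set: quotmod p] #= `I_q)%card ->
  (ncard (calL p n a b) *
    (nfree q a a * nfree q b b * q ^ (b * a) * q ^ ((a + b) * b)) =
   q ^ (n * b) * nfree q n (a + b))%N.
Proof.
move=> dvr card_quot; have [pi pi0 pE] := principal_generator dvr.
have pfin : finite_set [set: quotmod p] by apply/finite_setP; exists q.
pose F := residue_field (dvr_maximal dvr) pfin.
have cardF : #|F| = q by apply: card_residue.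
pose phi : {rmorphism o -> F} := @to_residue o p (dvr_maximal dvr) pfin.
pose sigma : F -> o := @of_residue o p (dvr_maximal dvr) pfin.
have sigmaK : cancel sigma phi := @of_residueK o p (dvr_maximal dvr) pfin.
have phi_pi : phi pi = 0.
  by apply/to_residue_eq0/pE; exists 1; rewrite mulr1.
have phi_eq0 x : phi x = 0 -> exists c, x = pi * c.
  by move=> /to_residue_eq0/pE.
pose st : {linear 'rV[o]_(a + b) -> elem_mod p a b} := @std o p a b.
have st_surj : forall e, exists v, st v = e by exact: std_surj.
have st_eq0 : forall v, st v = 0 <->
    exists w1 w2, v = row_mx (pi *: w1) (pi ^+ 2 *: w2) by exact: std_eq0.
pose T := ('M[F]_(n, a + b) * 'M[F]_(n, b))%type.
pose ker (t : T) : set 'rV[o]_n := [set v | st (v *m lift_mx sigma pi t) = 0].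
pose A : {set T} := [set t : T | row_full t.1]%SET.
have calLE : calL p n a b = ker @` [set` A].
  (* An isomorphism [f] on the quotient by [S] gives the surjection [f \o qpi S] with kernel [S];
     conversely the first isomorphism theorem applies to each coded surjection. *)
  apply/seteqP; split=> [L [S [-> [f [g fK gK]]]]|_ [t tA <-]].
    pose h : {linear 'rV[o]_n -> elem_mod p a b} := f \o qpi S.
    have [t tE] := hom_lift sigmaK phi_eq0 st_surj st_eq0 h.
    exists t.
      rewrite /= inE.
      apply/(lift_surj sigmaK phi_pi phi_eq0 st_surj st_eq0) => e.
      by exists (qrepr (g e)); rewrite -tE /h /= qreprK gK.
    apply/seteqP; split=> v; rewrite /ker /= -tE /h /=.
      by move=> fv0; apply/qpi_eq0; rewrite -[LHS]fK fv0 -(linear0 f) fK.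
    by move=> /qpi_eq0 ->; rewrite linear0.
  pose h : {linear 'rV[o]_n -> elem_mod p a b} :=
    st \o mulmxr (lift_mx sigma pi t).
  exists (ker_submod h); split.
    by apply/seteqP; split=> v /= /ker_submodP.
  apply: (lmod_isom_quotmod (f := h)) => [v|].
    by split=> /ker_submodP.
  apply/(lift_surj sigmaK phi_pi phi_eq0 st_surj st_eq0).
  by rewrite /= inE in tA.
have cardU : #|[set u : 'M[F]_(a + b) * 'M[F]_(a + b, b) |
      row_free u.1 && (ursubmx u.1 == 0)]%SET| =
    (nfree q a a * nfree q b b * q ^ (b * a) * q ^ ((a + b) * b))%N.
  rewrite -cardF -card_row_free_lower_block -(card_mx F) -cardsT -cardsX.
  by apply: eq_card => u; rewrite !inE andbT.
rewrite calLE -cardU -(ncard_image_fibre (K := ker) (A := A)); last first.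
  move=> t; rewrite inE => tfull.
  rewrite -(card_same_ker sigmaK pi0 phi_pi phi_eq0 st_surj st_eq0 tfull).
  apply: eq_card => u; rewrite !inE; congr (_ && _).
  apply/eqP/asboolP => [/seteqP[ut tu] v|ut]; first by split=> [/ut|/tu].
  by apply/seteqP; split=> v /ut.
rewrite -cardF -card_row_full -(card_mx F) mulnC -cardsT -cardsX.
by apply: eq_card => u; rewrite !inE andbT.
Qed.

Theorem theorem3p8 (o : idomainType) (p : submodClosed o^o)
    (q : nat) (Fq : finFieldType) (n k : nat)
    (ho : is_compact_dvr p)
    (hq : ([set: quotmod p] #= `I_q)%card)
    (hFq : #|Fq| = q)
    (hn : (1 <= n)%N)
    (hk : (1 <= k <= n)%N) :
  Delta n k (q%:R : rat) =
  \sum_(k <= a < n.+1) \sum_(0 <= b < (n - a).+1)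
    (q%:R ^+ (b * (a + b + 1)) * (ncard (calL p n a b))%:R
      * #|Sym Fq a (a - k)|%:R).

Proof.
have [dvr _] := ho; have [k_gt0 kn] := andP hk.
have q_gt1 : (1 < q)%N by rewrite -hFq card_finNzRing_gt1.
apply: (@Delta_sum q q_gt1 n k (fun a b => ncard (calL p n a b))
  (fun a r => #|Sym Fq a r|)) => // [a b|a r|a].
- exact: card_calL.
- by rewrite -hFq card_Sym_rank.
- by rewrite -hFq sum_card_Sym.
Qed.
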